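(* Let $A_3(n)$ denote the number of $3$-dimensional polycubes with $n$ cells, counted up to translation, and let $\lambda_3=\lim_{n\to\infty}A_3(n+1)/A_3(n)$. Then $\lambda_3 \leq 9.8073$.
   Context: A $d$-dimensional polycube of size $n$ is a set of $n$ unit cubes (cells) of the cubical lattice $\mathbb{Z}^d$ that is connected via shared $(d-1)$-dimensional faces. Two polycubes are identified if one is a translate of the other (fixed polycubes). $A_d(n)$ is the number of such polycubes of size $n$. It is known that the limit $\lambda_d=\lim_{n\to\infty}A_d(n+1)/A_d(n)$ exists and equals $\lim_{n\to\infty}A_d(n)^{1/n}$. *)

(* Defs.v *)
From HB Require Import structures.
From mathcomp Require Import all_boot all_order all_algebra.
From mathcomp Require Import finmap.
From mathcomp Require Import all_classical all_reals all_analysis.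
From mathcomp Require Import zify.

Set Implicit Arguments.
Unset Strict Implicit.
Unset Printing Implicit Defensive.

Import Order.TTheory GRing.Theory Num.Theory.
Import numFieldNormedType.Exports.

Local Open Scope classical_set_scope.
Local Open Scope ring_scope.

(* The lattice point x : 'rV[int]_d stands for the unit cube x + [0, 1]^d. *)
Definition cell (d : nat) := 'rV[int]_d.

(* Two unit cubes x + [0, 1]^d and y + [0, 1]^d share a (d-1)-dimensional face
   exactly when y - x or x - y is a standard basis vector. *)
Definition share_face (d : nat) (x y : cell d) : bool :=
  [exists i : 'I_d,
     (y == x + delta_mx ord0 i) || (x == y + delta_mx ord0 i)].

(* [connect] is taken inside P: all intermediate cells belong to P. *)
Definition polycube (d : nat) (P : {fset cell d}) : bool :=
  [forall x : P, forall y : P,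
     connect [rel u v : P | share_face (val u) (val v)] x y].

Definition translate (d : nat) (v : cell d) (P : {fset cell d}) :
    {fset cell d} :=
  [fset (x + v)%R | x in P]%fset.

Definition translates (d : nat) (P : {fset cell d}) : set {fset cell d} :=
  [set translate v P | v in [set: cell d]].

(* A fixed polycube is a translation class of polycubes. *)
Definition fixed_polycubes (d n : nat) : set (set {fset cell d}) :=
  [set translates P | P in [set P : {fset cell d} |
     polycube P /\ #|` P|%fset = n]].
Arguments fixed_polycubes : clear implicits.

(* [fset_set] is only meaningful on finite sets; see
   [finite_fixed_polycubes] below. *)
Definition A (d n : nat) : nat := #|` fset_set (fixed_polycubes d n)|%fset.

Lemma translateD (d : nat) (u v : cell d) (P : {fset cell d}) :
  translate v (translate u P) = translate (u + v) P.
Proof.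
apply/fsetP=> z; apply/imfsetP/imfsetP => /=.
- by case=> _ /imfsetP[x /= xP ->] ->; exists x; rewrite ?addrA.
- case=> x xP ->; exists (x + u); rewrite ?addrA//.
  by apply/imfsetP; exists x.
Qed.

Lemma translates_translate (d : nat) (v : cell d) (P : {fset cell d}) :
  translates (translate v P) = translates P.
Proof.
apply/seteqP; split=> Q [u _ <-].
- by exists (v + u) => //; rewrite translateD.
- by exists (u - v) => //; rewrite translateD addrC subrK.
Qed.

Lemma share_face_coord (d : nat) (x y : cell d) (i : 'I_d) :
  share_face x y -> `|y ord0 i - x ord0 i| <= 1.
Proof.
case/existsP=> j /orP[] /eqP ->; rewrite !mxE /=; case: (i == j) => /=; lia.
Qed.

Lemma polycube_coord (d : nat) (P : {fset cell d}) (x y : P) (i : 'I_d) :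
  polycube P -> `|val y ord0 i - val x ord0 i| <= #|` P|%fset%:Z.
Proof.
move=> /forallP/(_ x)/forallP/(_ y)/connectP[p0 ep0 ->].
case/shortenP: ep0 => p ep up _ {p0}.
have -> : #|` P|%fset = #|{: P}| by rewrite cardfE.
have sp : (size p <= #|{: P}|)%N.
  have /= := max_card [in x :: p]; rewrite (card_uniqP up) => /ltnW.
  by [].
have {up} : `|val (last x p) ord0 i - val x ord0 i| <= (size p)%:Z.
  elim: p x ep {up sp} => [|z p IH] x /=; first by rewrite subrr normr0.
  case/andP=> /(share_face_coord i) h1 /IH /= h2; move: h1 h2.
  by move: (fsval z _ _) (fsval x _ _) (fsval (last z p) _ _) => a b c; lia.
by move=> /le_trans; apply; rewrite lez_nat.
Qed.

Lemma finite_fixed_polycubes (d n : nat) : finite_set (fixed_polycubes d n).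
Proof.
pose f (g : 'rV['I_(n + n).+1]_d) : cell d :=
  \row_i ((g ord0 i : nat)%:Z - n%:Z).
pose box : {fset cell d} := [fset f g | g in [set: 'rV['I_(n + n).+1]_d]%SET]%fset.
apply: (@sub_finite_set _ _
  ((@translates d) @` [set` fpowerset box])); last first.
  exact/finite_image/finite_fset.
move=> _ [P [cP nP] <-].
have [->|[x xP]] := fset_0Vmem P.
  by exists fset0 => //=; rewrite fpowersetE fsub0set.
exists (translate (- x) P); last exact: translates_translate.
rewrite /= fpowersetE; apply/fsubsetP=> _ /imfsetP[y /= yP ->].
have bnd i := @polycube_coord d P [` xP]%fset [` yP]%fset i cP.
apply/imfsetP; exists (\row_i inord `|(y ord0 i - x ord0 i + n%:Z)%R|%N) => /=.
  by rewrite inE.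
apply/rowP=> i; rewrite !mxE.
have := bnd i; rewrite /= nP => h.
move: h; move: (x ord0 i) (y ord0 i) => a b h.
rewrite inordK; last by lia.
lia.
Qed.

(* Main.v *)
(* Polycubes containing the origin are explored cell by cell. An open cell u
   discovered from p = u - e has the side neighbors u + t with t orthogonal to e
   and the front neighbor u + e; all neighbors of p have already been revealed.
   Processing u reveals its unknown neighbors; those that are occupied become
   open. Attach to a state the potential a^(number of open cells) *
   r^(number of unknown cells that are a side of some open cell). A new open
   cell u + d gets at most the new side cells u + d + t with t orthogonal to d
   and t <> -e, since u + d - e neighbors p, and u + d + t is shared by u + d and
   u + t when both are open. Hence the potential, weighted by x^(occupied cells),
   does not increase on average as soon as, for every e and every set U of
   directions other than -e,
     \sum_(S subset of U) (x a)^|S| r^(number of orthogonal pairs {d, t} avoiding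
       -e and meeting S) <= a r^(number of elements of U orthogonal to e).
   This holds for x = 5/48, a = 8/5, r = 4/3 (values found numerically), so the
   number of polycubes grows at most like (48/5)^n = 9.6^n. *)

From Stdlib Require Import NArith.
Require Import Defs.
From mathcomp Require Import all_boot all_order all_algebra.
From mathcomp Require Import all_classical all_reals all_analysis.
From mathcomp Require Import finmap zify ring lra.
Import Order.TTheory GRing.Theory Num.Theory.
Import numFieldNormedType.Exports.
Local Open Scope classical_set_scope.
Local Open Scope ring_scope.

Set Implicit Arguments.
Unset Strict Implicit.
Unset Printing Implicit Defensive.

(** * Subsets of directions and orthogonal pairs of directions *)

Fixpoint sublists (T : Type) (s : seq T) : seq (seq T) :=
  if s is d :: s' then sublists s' ++ map (cons d) (sublists s') else [:: [::]].

Lemma mem_sublists (T : eqType) (s1 s2 : seq T) :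
  (s1 \in sublists s2) = subseq s1 s2.
Proof.
elim: s2 s1 => [|d s2 IH] s1 /=; first by rewrite inE; case: s1.
rewrite mem_cat IH; case: s1 => [|c s1]; first by rewrite sub0seq.
case: eqVneq => [<-|ncd].
- rewrite mem_map; last by move=> ? ? [].
  rewrite IH orb_idl// => /cons_subseq; exact.
- by rewrite orb_idr// => /mapP[s' _ [cd _]]; rewrite cd eqxx in ncd.
Qed.

(** An axis and a sign, [true] being negative; plain data keeps the later enumeration computable. *)
Definition dir := (nat * bool)%type.

Definition dirs : seq dir := [seq (i, b) | i <- iota 0 3, b <- [:: false; true]].

Definition opp (d : dir) : dir := (d.1, ~~ d.2).

Definition perp (d t : dir) : bool := d.1 != t.1.

Definition step (d : dir) : cell 3 :=
  \row_(i < 3) (if (i : nat) == d.1 then (if d.2 then -1 else 1) else 0).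

Lemma step_opp (d : dir) : step (opp d) = - step d.
Proof.
apply/rowP => i; rewrite !mxE /=.
by case: ((i : nat) == d.1); case: d => _ [] /=; rewrite ?opprK ?oppr0.
Qed.

Lemma dirs_lt (d : dir) : (d \in dirs) = (d.1 < 3)%N.
Proof. by case: d => [[|[|[|i]]] []]. Qed.

Lemma step_inj : {in dirs &, injective step}.
Proof.
move=> [i b] [j c]; rewrite !dirs_lt /= => i3 j3 /rowP/(_ (Ordinal i3)).
rewrite !mxE /= eqxx; case: eqVneq => [->|_]; last by case: b.
by case: b; case: c.
Qed.

Lemma share_face_step (x y : cell 3) :
  share_face x y -> exists2 d, d \in dirs & y = x + step d.
Proof.
case/existsP => i xy.
have stepi : step (i : nat, false) = delta_mx ord0 i.
  by apply/rowP => j; rewrite !mxE /= -val_eqE; case: eqP.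
case/orP: xy => /eqP ->; [exists (i : nat, false) | exists (opp (i : nat, false))];
  rewrite ?dirs_lt ?ltn_ord// ?step_opp stepi//.
by rewrite addrK.
Qed.

(* The edges of the octahedron whose vertices are the directions, without the
   vertex pointing back from e. *)
Definition perp_pairs (e : dir) : seq (dir * dir) :=
  [seq p <- [seq (d, t) | d <- dirs, t <- dirs] |
    [&& (p.1.1 < p.2.1)%N, p.1 != opp e & p.2 != opp e]].

Definition touching_pairs (e : dir) (S : seq dir) : seq (dir * dir) :=
  [seq p <- perp_pairs e | (p.1 \in S) || (p.2 \in S)].

(** A cell u + d + t depends only on the unordered pair {d, t}, so each pair is listed once, smaller
    axis first. *)
Lemma touching_pairsP (e d t : dir) (S : seq dir) :
    d \in S -> d \in dirs -> t \in dirs -> perp d t ->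
    d != opp e -> t != opp e ->
  exists2 p, p \in touching_pairs e S & step d + step t = step p.1 + step p.2.
Proof.
move=> dS dd td; rewrite /perp neq_ltn => /orP[lt_dt|lt_td] de te.
- exists (d, t) => //.
  rewrite mem_filter dS mem_filter andTb; apply/andP.
  by split; [exact/and3P | exact: allpairs_f].
- exists (t, d); last by rewrite addrC.
  rewrite mem_filter dS orbT mem_filter andTb; apply/andP.
  by split; [exact/and3P | exact: allpairs_f].
Qed.

(** * Counting polycubes with a prescribed trace on the known cells *)

Section Exploration.

Context (R : realType) (x : R) (n : nat).
Hypothesis x_ge0 : 0 <= x.

Definition neighbors (v : cell 3) (D : seq dir) : {fset cell 3} :=
  [fset (v + step d)%R | d in D]%fset.

Lemma neighborsP (v c : cell 3) (D : seq dir) :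
  reflect (exists2 d, d \in D & c = v + step d) (c \in neighbors v D).
Proof. by apply: (iffP (imfsetP _ _ _ _)) => -[d dD ->]; exists d. Qed.

Lemma mem_neighbors (v : cell 3) (D : seq dir) (d : dir) :
  d \in D -> v + step d \in neighbors v D.
Proof. by move=> dD; apply/neighborsP; exists d. Qed.

Definition extends (K Q P : {fset cell 3}) : Prop :=
  [/\ polycube P, #|` P|%fset = n & (P `&` K)%fset = Q].

(* K is the set of known cells and Q the set of known occupied ones. *)
Definition ext_bound (K Q : {fset cell 3}) (v : R) : Prop :=
  forall F : {fset {fset cell 3}}, (forall P, P \in F -> extends K Q P) ->
  #|` F|%fset%:R * x ^+ n <= v * x ^+ #|` Q|%fset.

Lemma ext_bound_le (K Q : {fset cell 3}) (v w : R) :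
  v <= w -> ext_bound K Q v -> ext_bound K Q w.
Proof.
by move=> vw Kv F /Kv/le_trans; apply; rewrite ler_wpM2r// exprn_ge0.
Qed.

(** Split the extensions by whether they contain [c]; if they do, [Q] gains one cell, which accounts
    for the factor [x]. *)
Lemma ext_bound_reveal (K Q : {fset cell 3}) (c : cell 3) (v w : R) :
    c \notin K -> (Q `<=` K)%fset ->
    ext_bound (c |` K)%fset Q v -> ext_bound (c |` K)%fset (c |` Q)%fset w ->
  ext_bound K Q (v + x * w).
Proof.
move=> cK QK Kv Kw F FKQ.
have cQ : c \notin Q by apply: contra cK; apply: (fsubsetP QK).
pose F1 := [fset P in F | c \in P]%fset; pose F0 := [fset P in F | c \notin P]%fset.
have sF : #|` F|%fset = (#|` F0|%fset + #|` F1|%fset)%N.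
  rewrite -cardfsUI; set I := (F0 `&` F1)%fset.
  have -> : I = fset0.
    by apply/fsetP => P; rewrite !inE /=; case: (c \in P); rewrite ?andbF.
  rewrite cardfs0 addn0; congr (#|` _|%fset).
  by apply/fsetP => P; rewrite !inE /=; case: (c \in P); rewrite ?andbT ?andbF ?orbF.
have /Kv b0 : forall P, P \in F0 -> extends (c |` K)%fset Q P.
  move=> P; rewrite !inE /= => /andP[/FKQ[cP nP PK] ncP]; split=> //.
  rewrite -PK; apply/fsetP => z; rewrite !inE; case: eqVneq => // ->.
  by rewrite (negPf ncP).
have /Kw b1 : forall P, P \in F1 -> extends (c |` K)%fset (c |` Q)%fset P.
  move=> P; rewrite !inE /= => /andP[/FKQ[cP nP PK] ncP]; split=> //.
  rewrite -PK; apply/fsetP => z; rewrite !inE; case: eqVneq => // ->.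
  by rewrite ncP.
rewrite sF natrD mulrDl mulrDl lerD//.
by apply: le_trans b1 _; rewrite cardfsU1 cQ add1n exprS mulrCA mulrA.
Qed.

(** The neighbors in directions [D] are revealed one at a time; [S] records the occupied ones. *)
Lemma ext_bound_neighbors (u : cell 3) (D : seq dir) (f : seq dir -> R)
    (K Q : {fset cell 3}) :
    uniq D -> {subset D <= dirs} -> (forall d, d \in D -> u + step d \notin K) ->
    (Q `<=` K)%fset ->
    (forall S, subseq S D ->
       ext_bound (K `|` neighbors u D)%fset (Q `|` neighbors u S)%fset (f S)) ->
  ext_bound K Q (\sum_(S <- sublists D) x ^+ size S * f S).
Proof.
elim: D f K Q => [|d D IH] f K Q.
  move=> _ _ _ _ /(_ [::] isT).
  have -> : neighbors u [::] = fset0.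
    by apply/fsetP => z; rewrite inE; apply/neighborsP => -[].
  by rewrite !fsetU0 /= big_seq1 expr0 mul1r.
rewrite /= => /andP[dD uD] Ddirs KD QK H.
rewrite big_cat big_map /=.
under [X in _ _ (_ + X)]eq_bigr do rewrite exprS -mulrA.
rewrite -mulr_sumr.
have nU S : neighbors u (d :: S) = ((u + step d)%R |` neighbors u S)%fset.
  apply/fsetP => z; rewrite in_fset1U; apply/neighborsP/orP.
  - case=> t; rewrite inE => /orP[/eqP-> ->|tS ->]; first by left.
    by right; apply: mem_neighbors.
  - case=> [/eqP->|/neighborsP[t tS ->]]; first by exists d; rewrite ?mem_head.
    by exists t; rewrite // inE tS orbT.
have K'D : forall t, t \in D -> u + step t \notin ((u + step d)%R |` K)%fset.
  move=> t tD; rewrite in_fset1U negb_or KD ?inE ?tD ?orbT// andbT.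
  apply: contra dD => /eqP/addrI/step_inj <-//; apply: Ddirs;
    by rewrite ?mem_head// inE tD orbT.
have D'dirs : {subset D <= dirs} by move=> t tD; apply: Ddirs; rewrite inE tD orbT.
have U1A B1 B2 : ((u + step d)%R |` B1 `|` B2 = B1 `|` ((u + step d)%R |` B2))%fset.
  by rewrite fsetUCA fsetUA.
apply: ext_bound_reveal => //; first by apply: KD; exact: mem_head.
- apply: IH => //; first exact: fsubset_trans QK (fsubsetUr _ _).
  move=> S SD; have := H S; rewrite nU U1A; apply.
  exact: subseq_trans SD (subseq_cons _ _).
- apply: (IH (fun S => f (d :: S))) => //; first exact: fsetUS.
  move=> S SD; have := H (d :: S); by rewrite /= eqxx !nU !U1A; apply.
Qed.

(** * Open cells, the frontier and the exploration invariant *)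

Definition sides (o : cell 3 * dir) : {fset cell 3} :=
  neighbors o.1 [seq t <- dirs | perp o.2 t].

(** These cells are counted by the exponent of [r] in the potential; a front neighbor enters only as
    a side of another open cell. *)
Definition frontier (K : {fset cell 3}) (O : seq (cell 3 * dir)) : {fset cell 3} :=
  ((\bigcup_(o <- O) sides o) `\` K)%fset.

Lemma frontierP (K : {fset cell 3}) (O : seq (cell 3 * dir)) (c : cell 3) :
  reflect (c \notin K /\ exists o t,
             [/\ o \in O, t \in dirs, perp o.2 t & c = o.1 + step t])
          (c \in frontier K O).
Proof.
rewrite in_fsetD; apply: (iffP andP) => -[cK].
- case/bigfcupP => o /andP[oO _] /neighborsP[t]; rewrite mem_filter => /andP[ot td] cE.
  by split=> //; exists o, t.
- case=> o [t [oO td ot cE]]; split=> //; apply/bigfcupP; exists o; first by rewrite oO.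
  by rewrite cE; apply: mem_neighbors; rewrite mem_filter ot.
Qed.

(* An open cell (u, d) was discovered from the cell u - step d. *)
Definition explored (K Q : {fset cell 3}) (O : seq (cell 3 * dir)) : Prop :=
  [/\ Q != fset0, (Q `<=` K)%fset,
     forall u d, (u, d) \in O ->
       [/\ d \in dirs, u \in Q, u - step d \in K &
           (neighbors (u - step d)%R dirs `<=` K)%fset] &
     forall u, u \in Q ->
       (exists d, (u, d) \in O) \/ (neighbors u dirs `<=` K)%fset].

(** With no open cell left, all neighbors of [Q] are known, so a path inside [P] starting in [Q]
    never leaves [Q]. *)
Lemma explored_nil (K Q P : {fset cell 3}) :
  explored K Q [::] -> extends K Q P -> P = Q.
Proof.
case=> /fset0Pn[q qQ] QK _ closed [cP _ PK].
have QP : (Q `<=` P)%fset by rewrite -PK fsubsetIl.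
apply/eqP; rewrite eqEfsubset QP andbT; apply/fsubsetP => z zP.
have /forallP/(_ [` zP]%fset) := forallP cP [` fsubsetP QP q qQ]%fset.
case/connectP => p; rewrite -[z]/(val [` zP]%fset) => + ->.
have : val [` fsubsetP QP q qQ]%fset \in Q by [].
elim: p [` _]%fset => [|v p IH] y //= yQ /andP[yv /IH]; apply.
have [d dd vE] := share_face_step yv.
have [[d' //]|/fsubsetP nK] := closed _ yQ.
have vK : fsval v \in K by apply: nK; rewrite vE; exact: mem_neighbors.
by rewrite -PK in_fsetI vK andbT; exact: fsvalP.
Qed.

Definition unknown (K : {fset cell 3}) (u : cell 3) : seq dir :=
  [seq d <- dirs | u + step d \notin K].

Definition open_all (u : cell 3) (S : seq dir) : seq (cell 3 * dir) :=
  [seq (u + step d, d) | d <- S].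

Lemma unknown_known (K : {fset cell 3}) (u : cell 3) :
  (neighbors u dirs `<=` K `|` neighbors u (unknown K u))%fset.
Proof.
apply/fsubsetP => _ /neighborsP[d dd ->]; rewrite inE.
case: (boolP (u + step d \in K)) => //= udK.
by apply: mem_neighbors; rewrite mem_filter udK.
Qed.

(** The invariant on [Q] may fail at [u], whose neighbors are all being revealed. This covers both
    an open cell just removed from the list and the initial origin. *)
Lemma explored_open (K Q : {fset cell 3}) (u : cell 3) (S : seq dir)
    (O : seq (cell 3 * dir)) :
    Q != fset0 -> (Q `<=` K)%fset -> u \in Q -> subseq S (unknown K u) ->
    (forall v d, (v, d) \in O ->
       [/\ d \in dirs, v \in Q, v - step d \in K &
           (neighbors (v - step d)%R dirs `<=` K)%fset]) ->
    (forall v, v \in Q ->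
       [\/ v = u, exists d, (v, d) \in O | (neighbors v dirs `<=` K)%fset]) ->
  explored (K `|` neighbors u (unknown K u))%fset (Q `|` neighbors u S)%fset
    (open_all u S ++ O).
Proof.
move=> Q0 QK uQ SU HO HQ; have KK' := fsubsetUl K (neighbors u (unknown K u)).
split.
- by case/fset0Pn: Q0 => q qQ; apply/fset0Pn; exists q; rewrite inE qQ.
- apply: fsetUSS => //; apply/fsubsetP => _ /neighborsP[d dS ->].
  exact/mem_neighbors/(mem_subseq SU).
- move=> v d; rewrite mem_cat => /orP[/mapP[d' dS [-> ->]]|/HO[dd vQ vK nK]].
    split; first by have := mem_subseq SU dS; rewrite mem_filter => /andP[].
    + by rewrite inE mem_neighbors// orbT.
    + by rewrite addrK (fsubsetP KK')// (fsubsetP QK).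
    + by rewrite addrK unknown_known.
  split=> //; first by rewrite inE vQ.
  + exact: (fsubsetP KK').
  + exact: fsubset_trans nK KK'.
- move=> v; rewrite inE => /orP[/HQ[->|[d vO]|nK]|/neighborsP[d dS ->]].
  + by right; apply: unknown_known.
  + by left; exists d; rewrite mem_cat vO orbT.
  + by right; apply: fsubset_trans nK KK'.
  + by left; exists d; rewrite mem_cat; apply/orP; left; apply/mapP; exists d.
Qed.

Lemma card_neighbors (u : cell 3) (D : seq dir) :
  uniq D -> {subset D <= dirs} -> #|` neighbors u D|%fset = size D.
Proof.
move=> uD Dd; rewrite card_in_imfset/=; first by rewrite undup_id.
by move=> d t dD tD /addrI; apply: step_inj; apply: Dd.
Qed.

(** Revealing around [u] removes its unknown sides from the frontier and adds at most one cell per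
    touching pair. The first conjunct makes the subtraction exact. *)
Lemma frontier_open (K Q : {fset cell 3}) (u : cell 3) (e : dir) (S : seq dir)
    (O : seq (cell 3 * dir)) :
    explored K Q ((u, e) :: O) -> subseq S (unknown K u) ->
  (size [seq d <- unknown K u | perp e d] <= #|` frontier K ((u, e) :: O)|%fset)%N /\
  (#|` frontier (K `|` neighbors u (unknown K u)) (open_all u S ++ O)|%fset <=
   #|` frontier K ((u, e) :: O)|%fset - size [seq d <- unknown K u | perp e d]
   + size (touching_pairs e S))%N.
Proof.
move=> [Q0 QK HO _] SU; set U := unknown K u.
have [ed uQ ueK /fsubsetP neK] := HO u e (mem_head _ _).
set V := [seq d <- U | perp e d].
have Vd : {subset V <= dirs} by move=> d; rewrite !mem_filter => /and3P[].
have uV : uniq V by rewrite !filter_uniq.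
have VF : (neighbors u V `<=` frontier K ((u, e) :: O))%fset.
  apply/fsubsetP => _ /neighborsP[d + ->].
  rewrite !mem_filter => /and3P[ed' udK dd]; apply/frontierP; split=> //.
  by exists (u, e), d; rewrite mem_head.
rewrite -(card_neighbors u uV Vd) fsubset_leq_card//; split=> //.
rewrite -cardfsDS//.
pose N := [fset (u + (step p.1 + step p.2))%R | p in touching_pairs e S]%fset.
have sN : (#|` N|%fset <= size (touching_pairs e S))%N.
  by apply: leq_trans (leq_imfset_card _ _ _) _; rewrite /= size_undup.
apply: (@leq_trans #|` (frontier K ((u, e) :: O) `\` neighbors u V `|` N)%fset|%fset);
  last by rewrite (leq_trans (leq_card_fsetU _ _).1)// leq_add2l.
apply/fsubset_leq_card/fsubsetP => c /frontierP[cKU [w [t [wO td ot cE]]]].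
have /andP[cK cU] : (c \notin K) && (c \notin neighbors u U).
  by rewrite -negb_or -in_fsetU.
move: wO; rewrite mem_cat => /orP[].
- case/mapP => d dS wE; move: ot cE; rewrite {}wE /= => dt cE.
  have := mem_subseq SU dS; rewrite mem_filter => /andP[udK dd].
  (* Otherwise [c] is u + d - e, a neighbor of u - e and hence known. *)
  have te : t != opp e.
    apply: contra cK => /eqP tE; rewrite cE tE step_opp addrAC.
    by rewrite neK// mem_neighbors.
  have de : d != opp e.
    by apply: contra udK => /eqP ->; rewrite step_opp.
  have [p pS pE] := touching_pairsP dS dd td dt de te.
  rewrite inE; apply/orP; right; apply/imfsetP; exists p => //=.
  by rewrite cE -addrA pE.
- move=> wO; rewrite inE; apply/orP; left; rewrite in_fsetD; apply/andP; split.
    apply: contra cU => /neighborsP[d + ->]; rewrite mem_filter => /andP[_ dU].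
    exact: mem_neighbors.
  by apply/frontierP; split=> //; exists w, t; rewrite inE wO orbT.
Qed.

(** * The potential bounds the number of extensions *)

Lemma ext_bound_large (K Q : {fset cell 3}) (v : R) :
  (n < #|` Q|%fset)%N -> 0 <= v -> ext_bound K Q v.
Proof.
move=> nQ v0 F FKQ; suff -> : F = fset0 by rewrite cardfs0 mul0r mulr_ge0 ?exprn_ge0.
apply/eqP; apply: contraTT isT => /fset0Pn[P /FKQ[_ nP PK]].
have /fsubset_leq_card : (Q `<=` P)%fset by rewrite -PK fsubsetIl.
by rewrite nP leqNgt nQ.
Qed.

Context (a r : R).
Hypothesis (a_ge0 : 0 <= a) (r_ge1 : 1 <= r).
Hypothesis superharmonic : forall e U, e \in dirs -> subseq U dirs -> opp e \notin U ->
  \sum_(S <- sublists U) (x * a) ^+ size S * r ^+ size (touching_pairs e S) <=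
  a * r ^+ size [seq d <- U | perp e d].

Lemma ext_bound_potential (K Q : {fset cell 3}) (O : seq (cell 3 * dir)) :
  explored K Q O -> ext_bound K Q (a ^+ size O * r ^+ #|` frontier K O|%fset).
Proof.
have r0 : 0 <= r by apply: le_trans r_ge1.
(* Processing a cell with s occupied new neighbors changes the number of open cells by s - 1 and
   lowers [n - #|Q|] by s, so the measure drops. *)
have [m] := ubnP ((n - #|` Q|%fset).*2 + size O).
elim: m K Q O => // m IH K Q O mQO KQO.
case: O mQO KQO => [|[u e] O] mQO KQO.
  move=> F FKQ; rewrite expr0 mul1r.
  have r1 : 1 <= r ^+ #|` frontier K [::]|%fset by rewrite exprn_ege1.
  have FQ : (F `<=` [fset Q])%fset.
    by apply/fsubsetP => P /FKQ /(explored_nil KQO) ->; rewrite inE.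
  have [->|] := eqVneq F fset0.
    by rewrite cardfs0 mul0r !mulr_ge0 ?exprn_ge0.
  (* If [F] is nonempty then [Q] itself has [n] cells, so both powers of [x] agree. *)
  case/fset0Pn => P PF; have [_ nP _] := FKQ P PF.
  rewrite -nP (explored_nil KQO (FKQ P PF)) ler_wpM2r ?exprn_ge0//.
  apply: le_trans r1; rewrite lern1.
  by apply: leq_trans (fsubset_leq_card FQ) _; rewrite cardfs1.
have [Q0 QK HO HQ] := KQO.
have [ed uQ ueK neK] := HO u e (mem_head _ _).
set U := unknown K u; set V := [seq d <- U | perp e d].
have Ud : {subset U <= dirs} by move=> d; rewrite mem_filter => /andP[].
have uU : uniq U by rewrite filter_uniq.
have UK d : d \in U -> u + step d \notin K by rewrite mem_filter => /andP[].
set b := #|` frontier K _|%fset.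
(* The potential after finding [S] occupied, with the frontier replaced by its upper bound; this is
   legitimate since [r] is at least 1. *)
pose f S := a ^+ (size S + size O) * r ^+ (b - size V + size (touching_pairs e S)).
apply: ext_bound_le (ext_bound_neighbors uU Ud UK QK (f := f) _).
- have Vb : (size V <= b)%N by have [] := frontier_open KQO (sub0seq _).
  have eU : opp e \notin U by rewrite mem_filter step_opp ueK.
  have -> : \sum_(S <- sublists U) x ^+ size S * f S =
      a ^+ size O * r ^+ (b - size V) *
      \sum_(S <- sublists U) (x * a) ^+ size S * r ^+ size (touching_pairs e S).
    rewrite mulr_sumr; apply: eq_bigr => S _; rewrite /f exprMn !exprD.
    rewrite [in RHS]mulrACA -!mulrA mulrCA; congr (_ * _).
    by rewrite mulrCA; congr (_ * _); rewrite mulrCA.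
  have := superharmonic ed (filter_subseq _ _) eU; rewrite -/V => /ler_wpM2l le.
  apply: le_trans (le _ _) _; first by rewrite mulr_ge0 ?exprn_ge0.
  by rewrite /= exprS -[in leRHS](subnK Vb) exprD [leLHS]mulrACA [_ * a]mulrC.
- move=> S SU; have [_ fr] := frontier_open KQO SU.
  have Sd : {subset S <= dirs} by move=> d /(mem_subseq SU)/Ud.
  have cQ : #|` (Q `|` neighbors u S)|%fset = (#|` Q|%fset + size S)%N.
    rewrite cardfsU (_ : (Q `&` _)%fset = fset0) ?cardfs0 ?subn0.
      by rewrite card_neighbors// (subseq_uniq SU).
    apply/eqP; apply: contraTT isT => /fset0Pn[c]; rewrite inE => /andP[cQ].
    case/neighborsP => d /(mem_subseq SU) dU cE.
    by have := UK d dU; rewrite -cE (fsubsetP QK).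
  (* Branches with more than [n] occupied cells have no extension; in the others [n - #|Q|] is not
     truncated and the measure decreases. *)
  have [nQS|QSn] := ltnP n #|` (Q `|` neighbors u S)%fset|%fset.
    by apply: ext_bound_large => //; rewrite mulr_ge0 ?exprn_ge0.
  apply: ext_bound_le (IH _ _ (open_all u S ++ O) _ _).
  + rewrite /f size_cat size_map ler_wpM2l ?exprn_ge0//.
    by apply: ler_weXn2l.
  + move: mQO QSn; rewrite cQ size_cat size_map /=.
    move: #|` Q|%fset (size S) (size O) => q s o; lia.
  + apply: explored_open => //.
    * by move=> v d vO; apply: HO; rewrite inE vO orbT.
    * move=> v /HQ[[d]|nK]; last by constructor 3.
      rewrite inE => /orP[/eqP[-> _]|vO]; first by constructor 1.
      by constructor 2; exists d.
Qed.

(** The origin has no discovery direction, so its six neighbors are revealed separately before the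
    potential applies. *)
Lemma ext_bound_origin :
  ext_bound [fset 0]%fset [fset 0]%fset
    (\sum_(S <- sublists dirs) x ^+ size S * (a ^+ size S *
       r ^+ #|` frontier ([fset 0] `|` neighbors 0 dirs) (open_all 0 S)|%fset)).
Proof.
have U0 : unknown [fset 0]%fset 0 = dirs.
  apply/all_filterP/allP => d dd; rewrite inE add0r.
  apply/eqP => /rowP d0; move: dd; rewrite dirs_lt => d3.
  by have := d0 (Ordinal d3); rewrite !mxE /= eqxx; case: d.2.
apply: (ext_bound_neighbors (u := 0)) => //.
  by move=> d; rewrite -{1}U0 /unknown mem_filter => /andP[].
move=> S Sd; rewrite -(size_map (fun d => ((0 : cell 3) + step d, d)) S) -/(open_all 0 S).
apply: ext_bound_potential; rewrite -[open_all _ _]cats0.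
have := @explored_open [fset 0]%fset [fset 0]%fset 0 S [::].
rewrite U0; apply=> //.
- by apply/fset0Pn; exists 0; rewrite inE.
- by rewrite inE.
- by move=> v; rewrite inE => /eqP ->; constructor 1.
Qed.

End Exploration.

(** * From translation classes to polycubes containing the origin *)

Lemma polycube_translate (d : nat) (v : cell d) (P : {fset cell d}) :
  polycube P -> polycube (translate v P).
Proof.
move=> cP.
have vP (z : P) : fsval z + v \in translate v P.
  by apply/imfsetP; exists (fsval z) => //; apply: fsvalP.
pose f (z : P) : translate v P := [` vP z]%fset.
have fE (z : translate v P) : exists y, z = f y.
  have /imfsetP[y yP zE] := fsvalP z.
  by exists [` yP]%fset; apply: val_inj.
apply/forallP => z; apply/forallP => w; have [[z0 ->] [w0 ->]] := (fE z, fE w).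
have /forallP/(_ w0)/connectP[p + ->] := forallP cP z0.
elim: p z0 => [|y p IH] z0 /=; first by move=> _; apply: connect0.
case/andP=> z0y /IH; apply: connect_trans; apply: connect1 => /=.
by case/existsP: z0y => i h; apply/existsP; exists i;
  rewrite ![_ + v + _]addrAC !(inj_eq (addIr v)).
Qed.

Lemma fixed_polycubes_origin (n : nat) (X : set {fset cell 3}) :
    (0 < n)%N -> fixed_polycubes 3 n X ->
  exists P, extends n [fset 0]%fset [fset 0]%fset P /\ translates P = X.
Proof.
move=> n0 [P [cP nP] <-].
have /fset0Pn[q qP] : P != fset0 by rewrite -cardfs_gt0 nP.
exists (translate (- q) P); split; last exact: translates_translate.
split; first exact: polycube_translate.
- by rewrite card_imfset//; apply: addIr.
- apply/eqP; rewrite eqEfsubset fsubsetIr fsub1set !inE eqxx andbT.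
  by apply/imfsetP; exists q; rewrite //= subrr.
Qed.

(** One representative through the origin is chosen per class; a representative determines its
    class, so the choice is injective. *)
Lemma card_fixed_polycubes_le (R : realType) (x : R) (n : nat) (C : R) :
    (0 < n)%N -> ext_bound x n [fset 0]%fset [fset 0]%fset C ->
  (A 3 n)%:R * x ^+ n <= C * x.
Proof.
move=> n0 b.
have /boolp.choice[rep repP] : forall X, exists P, fixed_polycubes 3 n X ->
    extends n [fset 0]%fset [fset 0]%fset P /\ translates P = X.
  move=> X; have [/(fixed_polycubes_origin n0)[P PX]|nX] := pselect (fixed_polycubes 3 n X).
    by exists P.
  (* A dummy value outside the fixed polycubes. *)
  by exists fset0 => /nX.
have fX X : X \in fset_set (fixed_polycubes 3 n) -> fixed_polycubes 3 n X.
  by rewrite (in_fset_set (@finite_fixed_polycubes 3 n)) => /set_mem.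
pose F := [fset rep X | X in fset_set (fixed_polycubes 3 n)]%fset.
have <- : #|` F|%fset = A 3 n.
  rewrite card_in_imfset//= => X Y /fX/repP[_ XE] /fX/repP[_ YE] repXY.
  by rewrite -XE -YE repXY.
have := b F; rewrite cardfs1 expr1; apply => P /imfsetP[X /fX/repP[PX _] ->].
exact: PX.
Qed.

(** * Verification of the superharmonic inequality by computation *)

Definition Npow (b : N) (k : nat) : N := iter k (N.mul b) 1%num.

(* The weight 6^-|S| (4/3)^t multiplied by 6^5 3^8. *)
Definition scaled_weight (e : dir) (S : seq dir) : N :=
  let t := size (touching_pairs e S) in
  (Npow 6 (5 - size S) * (Npow 4 t * Npow 3 (8 - t)))%num.

(** The inequality multiplied by 5 * 3^k * 6^5 * 3^8. Without -e there remain 5 directions and 12 -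
    4 = 8 octahedron edges; checking these bounds shows that no subtraction in [scaled_weight]
    truncates. *)
Definition superharmonic_at (e : dir) (U : seq dir) : bool :=
  (opp e \in U) ||
  (all (fun S => (size S <= 5)%N && (size (touching_pairs e S) <= 8)%N) (sublists U) &&
   let k := size [seq d <- U | perp e d] in
   N.leb (5 * (Npow 3 k * foldr (fun S => N.add (scaled_weight e S)) 0%num (sublists U)))%num
         (8 * (Npow 4 k * (Npow 6 5 * Npow 3 8)))%num).

Lemma superharmonic_dirs :
  all (fun e => all (superharmonic_at e) (sublists dirs)) dirs.
Proof. by vm_compute. Qed.

Lemma superharmonic_ineq (R : realFieldType) (e : dir) (U : seq dir) :
    e \in dirs -> subseq U dirs -> opp e \notin U ->
  \sum_(S <- sublists U)
    (5 / 48 * (8 / 5)) ^+ size S * (4 / 3) ^+ size (touching_pairs e S) <=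
  8 / 5 * (4 / 3) ^+ size [seq d <- U | perp e d] :> R.
Proof.
move=> ed; rewrite -mem_sublists => Ud eU.
pose phi (m : N) : R := (N.to_nat m)%:R.
have phiD p q : phi (p + q)%num = phi p + phi q by rewrite /phi N2Nat.inj_add -natrD.
have phiM p q : phi (p * q)%num = phi p * phi q by rewrite /phi N2Nat.inj_mul -natrM.
have phiX b k : phi (Npow b k) = phi b ^+ k.
  by elim: k => [|k IH] //; rewrite exprS -IH -phiM.
have phiE : ((phi 3%num = 3) * (phi 4%num = 4) * (phi 5%num = 5) * (phi 6%num = 6)
  * (phi 8%num = 8))%type by [].
have phi_le p q : N.leb p q -> phi p <= phi q.
  by move/N.leb_le => pq; rewrite ler_nat; apply/ssrnat.leP; lia.
have := allP (allP superharmonic_dirs e ed) U Ud.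
rewrite /superharmonic_at (negPf eU) orFb => /andP[/allP bnd /phi_le].
have -> p i j : phi (8 * (Npow 4 p * (Npow 6 i * Npow 3 j)))%num =
    8 * (4 ^+ p * (6 ^+ i * 3 ^+ j)) by rewrite !phiM !phiX !phiE.
rewrite !phiM phiX !phiE; set k := size _.
have -> : phi (foldr (fun S => N.add (scaled_weight e S)) 0%num (sublists U)) =
    6 ^+ 5 * 3 ^+ 8 * \sum_(S <- sublists U)
      (5 / 48 * (8 / 5)) ^+ size S * (4 / 3) ^+ size (touching_pairs e S).
  elim: (sublists U) bnd => [|S s IH] bnd /=; first by rewrite big_nil mulr0.
  rewrite phiD IH; last by move=> T Ts; apply: bnd; rewrite inE Ts orbT.
  have /andP[S5 t8] := bnd S (mem_head _ _).
  rewrite big_cons mulrDr; congr (_ + _).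
  have split_exp (b : R) i j : (i <= j)%N -> b ^+ j = b ^+ (j - i) * b ^+ i.
    by move=> ij; rewrite -exprD subnK.
  rewrite /scaled_weight !phiM !phiX !phiE (split_exp 6 _ _ S5) (split_exp 3 _ _ t8).
  move: (size S) (size (touching_pairs e S)) S5 t8 => m t m5 t8.
  rewrite (_ : 5 / 48 * (8 / 5) = 6^-1 :> R); last by field.
  have [m0 t0] : 6 ^+ m != 0 :> R /\ 3 ^+ t != 0 :> R by rewrite !expf_neq0 ?pnatr_eq0.
  rewrite exprVn expr_div_n; move: m0 t0.
  move: (6 ^+ m) (3 ^+ t) (6 ^+ (5 - m)) (3 ^+ (8 - t)) (4 ^+ t) => a b c d f a0 b0.
  by field; rewrite a0 b0.
rewrite expr_div_n; have w0 : 0 < 6 ^+ 5 * 3 ^+ 8 :> R by rewrite mulr_gt0 ?exprn_gt0.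
have p0 : 0 < 3 ^+ k :> R by rewrite exprn_gt0.
move: (\sum_(_ <- _) _) (3 ^+ k) (4 ^+ k) (6 ^+ 5 * 3 ^+ 8) p0 w0 => s p q w p0 w0 le.
have e0 : 0 < 5 * (p * w) by rewrite !mulr_gt0.
rewrite -(ler_pM2l e0) -!mulrA; apply: le_trans le _.
by rewrite le_eqVlt; apply/orP; left; apply/eqP; field; rewrite gt_eqF.
Qed.

(** * The growth rate *)

Lemma bernoulli_ineq (R : realFieldType) (d : R) (k : nat) :
  0 <= d -> 1 + k%:R * d <= (1 + d) ^+ k.
Proof.
move=> d0; elim: k => [|k IH]; first by rewrite mul0r addr0 expr0.
rewrite exprS; apply: le_trans (ler_wpM2l _ IH); last by rewrite addr_ge0.
have : 0 <= k%:R * d * d by rewrite !mulr_ge0.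
rewrite -natr1; nra.
Qed.

Lemma card_polycubes_le (R : realType) :
  exists C : R, forall n, (0 < n)%N -> (A 3 n)%:R * (5 / 48) ^+ n <= C.
Proof.
(* The constant is the finite sum of [ext_bound_origin] times [x]; frontier sizes around the origin
   do not involve [n]. *)
eexists => n n0; apply: (card_fixed_polycubes_le n0).
apply: (@ext_bound_origin _ _ _ _ (8 / 5) (4 / 3)); [lra | lra | lra |].
exact: superharmonic_ineq.
Qed.

Theorem theorem3 (R : realType) (lambda3 : R)
  (lambda3_lim : (A 3 n.+1)%:R / (A 3 n)%:R @[n --> \oo] --> lambda3) :
  lambda3 <= 98073%:R / 10000%:R.
Proof.
rewrite leNgt; apply/negP => lt.
set c : R := 98073%:R / 10000%:R in lt.
have c0 : 0 < c by rewrite /c; lra.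
have [N _ ratio] := cvgr_gt _ lambda3_lim _ lt.
have pos m : (N <= m)%N -> 0 < (A 3 m)%:R :> R.
  (* If [A 3 m] were 0, the ratio would be 0 by the convention for division by zero, yet it exceeds
     [c]. *)
  move=> /ratio /=; rewrite ltr0n lt0n; case: eqP => // ->.
  by rewrite invr0 mulr0 ltNge (ltW c0).
(* Starting at [N.+1] keeps the index positive, as [bound] requires. *)
have grow k : c ^+ k <= (A 3 (N.+1 + k))%:R.
  elim: k => [|k IH].
    by rewrite expr0 ler1n -(ltr0n R) pos// addn0.
  rewrite addnS exprS; apply: le_trans (ler_wpM2l (ltW c0) IH) _.
  have Nk : (N <= N.+1 + k)%N by rewrite addSn -addnS leq_addr.
  by rewrite -ler_pdivlMr ?pos//; apply/ltW/ratio.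
have [C bound] := card_polycubes_le R.
pose x : R := 5 / 48; have x0 : 0 < x by rewrite /x; lra.
(* The powers of [c * x] are bounded, while c * x > 1 because 9.8073 > 48/5; Bernoulli makes the
   growth linear. *)
have geom k : 1 + k%:R * (c * x - 1) <= C / x ^+ N.+1.
  rewrite ler_pdivlMr ?exprn_gt0//.
  apply: le_trans (bound (N.+1 + k)%N isT); rewrite -/x exprD [leLHS]mulrC [leRHS]mulrCA.
  rewrite ler_wpM2l ?exprn_ge0 ?(ltW x0)//.
  apply: le_trans (ler_wpM2r _ (grow k)); last by rewrite exprn_ge0// ltW.
  rewrite -exprMn; apply: le_trans (bernoulli_ineq _ _) _; first by rewrite /c /x; lra.
  by rewrite addrC subrK.
(* The factor 100 works since c * x - 1 > 1/100: any k > 100 M contradicts [geom]. *)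
pose M := C / x ^+ N.+1; have M0 : 0 <= M * 100.
  by have := geom 0%N; rewrite mul0r addr0 -/M; lra.
have := archi_boundP M0; have := geom (Num.bound (M * 100)); rewrite -/M.
move: (_%:R) => k kM Mk; move: kM; rewrite /c /x; lra.
Qed.
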